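(* Let $l$, $n$ and $d\geqslant n$ be positive integers. Then every word over an $l$-letter ordered alphabet of length at least $\Psi(n,d,l)$ either contains a subword of the form $x^d$ with $x$ a nonempty word, or is $n$-divisible, where $$\Psi(n,d,l)=4^{5+3\log_3 4}\, l\,(nd)^{3\log_3(nd)+(5+6\log_3 4)}\,d^2.$$
   Context: Words are finite words over an alphabet $a_1\prec a_2\prec\dots\prec a_l$; a subword is a contiguous factor. The order on letters induces the (partial) lexicographic order on words: two words, one of which is a prefix of the other, are called incomparable; otherwise the words are compared by the letters at the first position where they differ. The notation $u\succ v$ means that $u$ and $v$ are comparable and $u$ is lexicographically larger than $v$. A word $W$ is $n$-divisible if it can be written as $W=vu_1u_2\cdots u_n$ with words $v,u_1,\dots,u_n$ such that $u_1\succ u_2\succ\dots\succ u_n$. *)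

(* Defs.v *)
From HB Require Import structures.
From mathcomp Require Import all_boot all_order all_algebra.
From mathcomp Require Import reals exp.

Set Implicit Arguments.
Unset Strict Implicit.
Unset Printing Implicit Defensive.

Import Order.TTheory GRing.Theory Num.Theory.

(* [lex_gt u v] is u ≻ v. A word is not comparable with its prefixes, so this
   is not the strict order of [seqlexi], for which a proper prefix is smaller. *)
Fixpoint lex_gt (disp : Order.disp_t) (A : orderType disp) (u v : seq A) :
    bool :=
  match u, v with
  | a :: u', b :: v' => (b < a)%O || ((a == b) && lex_gt u' v')
  | _, _ => false
  end.

Lemma lex_gtP (disp : Order.disp_t) (A : orderType disp) (u v : seq A) :
  reflect (exists (p s t : seq A) (a b : A),
             [/\ u = p ++ a :: s, v = p ++ b :: t & (b < a)%O])
          (lex_gt u v).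
Proof.
apply: (iffP idP); last first.
  case=> p [s] [t] [a] [b] [-> -> ltba].
  by elim: p => [|c p IHp] /=; rewrite ?ltba // eqxx IHp orbT.
elim: u v => [|a u IHu] [|b v] //= /orP[ltba|/andP[/eqP <- /IHu]].
  by exists [::], u, v, a, b.
by case=> p [s] [t] [c] [e] [-> -> ltec]; exists (a :: p), s, t, c, e.
Qed.

Definition word_pow (T : Type) (x : seq T) (d : nat) : seq T :=
  flatten (nseq d x).

Definition has_power (T : eqType) (d : nat) (W : seq T) : Prop :=
  exists2 x : seq T, x != [::] & infix (word_pow x d) W.

Definition n_divisible (disp : Order.disp_t) (A : orderType disp) (n : nat)
    (W : seq A) : Prop :=
  exists (v : seq A) (us : seq (seq A)),
    [/\ size us = n, W = v ++ flatten us & sorted (@lex_gt disp A) us].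

Local Open Scope ring_scope.

Definition log3 (R : realType) (x : R) : R := ln x / ln 3.

Definition Psi (R : realType) (n d l : nat) : R :=
  let nd : R := (n * d)%:R in
  4 `^ (5 + 3 * log3 4) * l%:R
  * nd `^ (3 * log3 nd + (5 + 6 * log3 4)) * d%:R ^+ 2.

(* Main.v *)
Require Import Defs.
From mathcomp Require Import all_boot all_order all_algebra.
From mathcomp Require Import reals sequences exp.
From mathcomp Require Import boolp zify ring.

(** Suppose that [W] is not n-divisible and contains no d-th power.  For a
    length [q], consider the q-window at each position, that is, the factor of
    length [q] starting there.  The windows are controlled by colourings of the
    positions: a colouring is called separating when two positions whose
    windows decrease from left to right get different colours.  Along one
    colour the windows then weakly increase, so they can change only a few times,
    and some long interval of positions sees no change at all
    ([determines_block]): on it the colour of a position determines its window.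

    If [N] colours determine the p-windows on an interval, then the 3p-windows
    are determined by triples of colours, and a further subinterval, shorter
    by a factor of about [N ^ 3], has its 3p-windows determined by a
    single colour ([tripling]).  Repeating this about [log_3 (n d)] times, from
    single letters up to windows of length [P >= n d], costs a factor
    [N ^ (3 log_3 (n d))].  At length [P] the pigeonhole principle gives n
    disjoint occurrences of one word of length [P]; its first n tails are
    pairwise comparable, or else the word contains a d-th power, so reading the
    tails in decreasing order off successive occurrences divides [W]
    ([determined_divisible]).

    It remains to find separating colourings with few colours, by bounding
    chains of decreasing windows.  For windows of length [q] there is one with
    [(n - 1) q] colours ([descent_coloring]): in a longer chain every q-th
    position starts a part of a division.  For long windows
    [descent_coloring_long] does better, with about [n d log_2 P] colours.
    Its logarithm cannot be afforded at every step, since the bound to prove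
    corresponds to [N = O (n d)] throughout.  The gain comes from the short
    windows: up to length [3 ^ r], about the fourth root of [n d] and so at
    most about the square root of [d], the first colouring is used, and its
    [n 3 ^ r] colours are so many fewer than [n d] that this pays for the
    logarithms of the longer windows ([core_bound]). *)

Set Implicit Arguments.
Unset Strict Implicit.
Unset Printing Implicit Defensive.

Import Order.TTheory GRing.Theory Num.Theory.

(** * Colourings, repeated keys and chains *)

(** Half of Mirsky's theorem: colour each point by the length of the longest
    chain that starts there. *)
Lemma chain_coloring (K : nat) (R : rel nat) :
    (forall i s, path R i s -> size s < K) ->
  exists c : nat -> 'I_K, forall i j, R i j -> c i <> c j.
Proof.
move=> boundR.
pose hasp i := [pred k | `[< exists2 s, path R i s & size s = k >]].
have ex_hasp i : exists k, hasp i k by exists 0; apply/asboolP; exists [::].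
have ub_hasp i k : hasp i k -> k <= K.
  by move=> /asboolP[s /boundR + <-]; apply: ltnW.
have lt_max i : ex_maxn (ex_hasp i) (ub_hasp i) < K.
  by case: ex_maxnP => k /asboolP[s /boundR + <-].
exists (fun i => Ordinal (lt_max i)) => i j Rij [].
case: ex_maxnP => k _ maxk; case: ex_maxnP => k' /asboolP[s sP <-] _ eqk.
have: hasp i (size s).+1 by apply/asboolP; exists (j :: s); rewrite //= Rij.
by move/maxk; rewrite eqk ltnn.
Qed.

(** The number of distinct keys seen from [a] on is at most [#|K|], so it
    stays constant over one of [#|K|] consecutive steps of size [S]; no new key
    then appears in the block between [x] and [x + S]. *)
Lemma repeating_block (K : finType) (f : nat -> K) (a len S : nat) :
    #|K| * S < len ->
  exists x, [/\ a <= x, x + S < a + len &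
    forall y, x <= y <= x + S -> exists2 z, a <= z <= x & f z = f y].
Proof.
move=> ltlen.
pose seen x := undup [seq f z | z <- iota a x].
have seenP x v : reflect (exists2 z, a <= z < a + x & f z = v) (v \in seen x).
  rewrite mem_undup; apply: (iffP mapP) => -[z].
    by rewrite mem_iota => zP ->; exists z.
  by move=> zP <-; exists z; rewrite ?mem_iota.
pose D t := size (seen (t * S).+1).
have [t ltt eqD] : exists2 t, t < #|K| & D t.+1 <= D t.
  apply/exists2P; apply: contrapT => noeq.
  have growD t : t <= #|K| -> t < D t.
    elim: t => [|t IHt] ltt; first by rewrite /D /seen mul0n /=.
    apply: leq_ltn_trans (IHt (ltnW ltt)) _; rewrite ltnNge; apply/negP => leD.
    by apply: noeq; exists t.
  have := growD _ (leqnn _).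
  by rewrite /D -(card_uniqP (undup_uniq _)) ltnNge max_card.
exists (a + t * S); split; first exact: leq_addr.
  have : t.+1 * S <= #|K| * S by rewrite leq_mul2r ltt orbT.
  by rewrite mulSn; lia.
move=> y /andP[lexy ltyx].
have subD : {subset seen (t * S).+1 <= seen (t.+1 * S).+1}.
  move=> v /seenP[z zP <-]; apply/seenP; exists z => //.
  by rewrite mulSn; lia.
have [_ eq_seen] := uniq_min_size (undup_uniq _) subD eqD.
have : f y \in seen (t.+1 * S).+1.
  by apply/seenP; exists y => //; rewrite mulSn; lia.
by rewrite -eq_seen => /seenP[z zP <-]; exists z => //; lia.
Qed.

Lemma pigeonhole (K : finType) (f : nat -> K) (n : nat) (s : seq nat) :
  #|K| * n < size s -> exists v, n < size [seq k <- s | f k == v].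
Proof.
move=> lts; apply/not_existsP => small; move: lts; apply/negP; rewrite -leqNgt.
have -> : size s = \sum_(v : K) size [seq k <- s | f k == v].
  under eq_bigr do rewrite size_filter -sum1_count big_mkcond.
  rewrite exchange_big /= -sum1_size; apply: eq_bigr => k _.
  by rewrite -big_mkcond (big_pred1 (f k)) // => v; rewrite /= eq_sym.
rewrite -sum_nat_const; apply: leq_sum => v _.
by rewrite leqNgt; apply/negP/small.
Qed.

Lemma path_last_rel (R : rel nat) i s :
  transitive R -> s != [::] -> path R i s -> R i (last i s).
Proof.
move=> trR; case: s => // j s _ /(order_path_min trR) /allP; apply.
exact: mem_last.
Qed.

Lemma leq_path_last (R : rel nat) i s :
  (forall j k, R j k -> j < k) -> path R i s -> i + size s <= last i s.
Proof.
move=> ltR; elim: s i => [|j s IHs] i /=; first by rewrite addn0.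
by move=> /andP[/ltR ltij /IHs]; apply: leq_trans; rewrite addnS -addSn leq_add2r.
Qed.

Lemma path_endpoints (R : rel nat) i s y :
    transitive R -> path R i s -> y \in i :: s ->
  (y = i \/ R i y) /\ (y = last i s \/ R y (last i s)).
Proof.
move=> trR Rs /splitPl ys; case: ys Rs => p1 p2 <-.
rewrite cat_path last_cat => /andP[Rp1 Rp2]; split.
  by case: p1 Rp1 {Rp2} => [|z p1] Rp1; [left | right; apply: path_last_rel].
by case: p2 Rp2 => [|z p2] Rp2; [left | right; apply: path_last_rel].
Qed.

(** One of the [size s] steps of a chain is at most the average step. *)
Lemma small_step D q i s :
    0 < size s -> path ltn i s -> D * (last i s - i) <= size s * q ->
  exists x g, [/\ 0 < g, D * g <= q, (x == i) || (x \in s) & x + g \in s].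
Proof.
elim: s i => [|j s IHs] i //= _ /andP[ltij ltjs] les.
have [le_step|gt_step] := leqP (D * (j - i)) q.
  by exists i, (j - i); rewrite eqxx subnKC ?mem_head ?subn_gt0 // ltnW.
have le_last : j <= last j s by have := leq_path_last (fun=> fun=> id) ltjs; lia.
case: s => [|k s] in IHs ltjs les le_last *; first by move: les => /=; lia.
have [||x [g [g_gt0 leg xP gP]]] := IHs j _ ltjs => //.
  have span : last k s - i = (last k s - j) + (j - i) by move: le_last => /=; lia.
  by move: les; rewrite /= span mulnDr (mulSn (size s).+1); lia.
by exists x, g; split; rewrite // inE ?xP ?gP orbT.
Qed.

(** * Powers and the lexicographic order *)

Lemma take_word_pow (A : Type) g k (T : seq A) :
  k.+1 * g <= size T -> take (k * g) (drop g T) = take (k * g) T ->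
  take (k.+1 * g) T = word_pow (take g T) k.+1.
Proof.
move=> + eqT; suff pow j : j <= k -> take (j.+1 * g) T = word_pow (take g T) j.+1.
  by move=> _; apply: pow.
elim: j => [|j IHj] lejk; first by rewrite mul1n /word_pow /= cats0.
transitivity (take g T ++ word_pow (take g T) j.+1); last by [].
rewrite mulSn takeD -IHj ?(ltnW lejk) //; congr (_ ++ _).
have le_jk : j.+1 * g <= k * g by rewrite leq_mul2r lejk orbT.
by rewrite -(take_takel _ le_jk) eqT take_takel.
Qed.

(** A factor that agrees over a length [q] with its shift by [g] has period
    [g], hence starts with [q %/ g + 1] copies of its first [g] letters. *)
Lemma periodic_has_power (A : eqType) d g i q (W : seq A) :
    0 < g -> d * g <= q + g -> i + g + q <= size W ->
    take q (drop (i + g) W) = take q (drop i W) ->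
  has_power d W.
Proof.
case: d => [|d] g_gt0 led leW eqT; last rewrite mulSn addnC leq_add2r in led.
  case: W leW eqT => [|a W] /=; first by lia.
  by exists [:: a].
exists (take g (drop i W)).
  rewrite -size_eq0 size_takel ?size_drop; first by rewrite -lt0n.
  by lia.
rewrite -take_word_pow; last 2 first.
- by rewrite size_drop mulSn; move: leW led; lia.
- by rewrite drop_drop (addnC g) -(take_takel _ led) eqT take_takel.
apply/infixP; exists (take i W), (drop (d.+1 * g) (drop i W)).
by rewrite !cat_take_drop.
Qed.

Section Words.
Variables (disp : Order.disp_t) (A : orderType disp).
Implicit Types (u v x y z T W : seq A).

Lemma lex_gtxx x : lex_gt x x = false.
Proof. by elim: x => //= a x ->; rewrite ltxx andbF. Qed.

Lemma lex_gt_trans : transitive (@lex_gt disp A).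
Proof.
move=> y x z; elim: x y z => [|a x IHx] [|b y] [|c z] //=.
move=> /orP[ltba|/andP[/eqP <- gtxy]] /orP[ltcb|/andP[/eqP <- gtyz]].
- by rewrite (lt_trans ltcb).
- by rewrite ltba.
- by rewrite ltcb.
- by rewrite eqxx (IHx _ _ gtxy) ?orbT.
Qed.

Lemma lex_gt_prefix x y x' y' :
  lex_gt x y -> prefix x x' -> prefix y y' -> lex_gt x' y'.
Proof.
move=> + /prefixP[s ->] /prefixP[t ->].
elim: x y => [|a x IHx] [|b y] //= /orP[->//|/andP[/eqP <- /IHx ->]].
by rewrite eqxx orbT.
Qed.

Lemma lex_gt_take k x y :
  lex_gt x y -> take k x != take k y -> lex_gt (take k x) (take k y).
Proof.
elim: x y k => [|a x IHx] [|b y] [|k] //= /orP[->//|/andP[/eqP <- gtxy]].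
by rewrite eqseq_cons eqxx /= orbC => /IHx ->.
Qed.

Lemma incomparable_prefix x y :
  ~~ lex_gt x y -> ~~ lex_gt y x -> size y <= size x -> prefix y x.
Proof.
elim: x y => [|a x IHx] [|b y] //=.
rewrite !negb_or -!leNgt => /andP[leab gtxy] /andP[leba gtyx].
have eqab : a = b by apply/eqP; rewrite eq_le leab leba.
by move: gtxy gtyx; rewrite eqab eqxx => ? ?; apply: IHx.
Qed.

Lemma nlex_gt_antisym x y :
  size x = size y -> ~~ lex_gt x y -> ~~ lex_gt y x -> x = y.
Proof.
move=> eqs gtxy gtyx.
have := incomparable_prefix gtxy gtyx; rewrite eqs leqnn => /(_ isT).
by rewrite prefixE -eqs take_size => /eqP.
Qed.

Lemma take_sandwich k x y z :
    lex_gt x y -> lex_gt y z -> take k x = take k z -> take k y = take k x.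
Proof.
elim: x y z k => [|a x IHx] [|b y] [|c z] [|k] //=.
move=> /orP[ltba|/andP[/eqP <- gtxy]] /orP[ltcb|/andP[/eqP <- gtyz]] [].
- by move=> eqac; move: (lt_trans ltcb ltba); rewrite eqac ltxx.
- by move=> eqac; move: ltba; rewrite eqac ltxx.
- by move=> eqac; move: ltcb; rewrite eqac ltxx.
- by move=> /(IHx _ _ _ gtxy gtyz) ->.
Qed.

(** Prepending letters to the first part [u] of a division of a tail turns it into a
    division of any larger tail [x], whichever of the two comparisons [x] with
    [u ++ s] and [u] with [v] is decided first. *)
Lemma lex_gt_substitute x u v s k :
  lex_gt x (u ++ s) -> lex_gt u v -> size u <= k -> lex_gt (take k x) v.
Proof.
elim: u v x k => [|a u IHu] [|b v] [|c x] [|k] //=.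
move=> /orP[ltac|/andP[/eqP -> gtx]] /orP[ltba|/andP[/eqP <- gtu]] ltk.
- by rewrite (lt_trans ltba).
- by rewrite ltac.
- by rewrite ltba.
- by rewrite eqxx IHu ?orbT.
Qed.

End Words.

(** * Divisions of the tails of a word *)

Section Division.
Variables (disp : Order.disp_t) (A : orderType disp) (W : seq A).
Implicit Types (u v : seq A) (us : seq (seq A)) (i j q m : nat).

Definition window q i := take q (drop i W).

Lemma window_lex_gt q i j :
  lex_gt (window q i) (window q j) -> lex_gt (drop i W) (drop j W).
Proof. by move=> /lex_gt_prefix; apply; apply: prefix_take. Qed.

Lemma windowD q r i : window (q + r) i = window q i ++ window r (i + q).
Proof. by rewrite /window takeD drop_drop addnC. Qed.

(** The tail at [i] is a division into [m + 1] decreasing parts, the first of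
    which is [u]. *)
Definition splits m i u := exists us,
  [/\ size us = m, drop i W = u ++ flatten us & sorted (@lex_gt disp A) (u :: us)].

Lemma splits0 i : splits 0 i (drop i W).
Proof. by exists [::]; split; rewrite //= cats0. Qed.

Lemma splits_n_divisible m k i u : splits m i u -> k <= m -> n_divisible k.+1 W.
Proof.
move=> [us [<- eqW lt_us]] lekm.
exists (take i W ++ flatten (take (size us - k) (u :: us))).
exists (drop (size us - k) (u :: us)); split.
- by rewrite size_drop /= subSn ?leq_subr // subKn.
- by rewrite -catA -flatten_cat cat_take_drop /= -eqW cat_take_drop.
- exact: drop_sorted.
Qed.

(** The two ways to transport a division from [j] to a position [i] on its
    left.  If the larger tail at [i] is distinguished early enough, it yields a
    new part; otherwise the first part can still be extended down to [i]. *)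
Lemma splits_cons m i j u :
    i <= j -> splits m j u -> lex_gt (take (j - i) (drop i W)) u ->
  splits m.+1 i (take (j - i) (drop i W)).
Proof.
move=> leij [us [<- eqW lt_us]] gtu; exists (u :: us); split => //=.
  by rewrite -eqW -{2}(subnK leij) -drop_drop cat_take_drop.
by rewrite gtu.
Qed.

Lemma splits_extend m i j u :
    i <= j -> splits m j u -> lex_gt (drop i W) (drop j W) ->
  splits m i (take (j - i + size u) (drop i W)).
Proof.
move=> leij [us [<- eqW lt_us]] gtij; exists us; split => //=.
  rewrite takeD drop_drop subnK // eqW take_size_cat // -catA -eqW.
  by rewrite -{2}(subnK leij) -drop_drop cat_take_drop.
case: us lt_us eqW => //= v us /andP[gtuv ->] eqW; rewrite andbT.
by apply: (lex_gt_substitute (u := u) (s := v ++ flatten us)); rewrite -?eqW ?leq_addl.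
Qed.

(** * Separating colourings *)

Definition descent q :=
  [rel i j | (i < j) && lex_gt (window q i) (window q j)].

Lemma descent_trans q : transitive (descent q).
Proof.
move=> y x z /= /andP[ltxy gtxy] /andP[ltyz gtyz].
by rewrite (ltn_trans ltxy) // (lex_gt_trans gtxy).
Qed.

(** Two elements of the chain that are [q] steps apart are at distance at least
    [q], so their windows do not overlap and every q-th element can start a
    part. *)
Lemma descent_splits q k i s :
    0 < q -> path (descent q) i s -> k * q <= size s ->
  exists2 u, splits k i u & prefix (window q i) u.
Proof.
move=> q_gt0; elim: k i s => [|k IHk] i s Rs les.
  by exists (drop i W); [apply: splits0 | apply: prefix_take].
move: Rs; rewrite -(cat_take_drop q s) cat_path => /andP[Rq Rs].
have leqs : q <= size s by apply: leq_trans les; rewrite mulSn leq_addr.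
have sizeq : size (take q s) = q by rewrite size_takel.
have leij : i + q <= last i (take q s).
  by rewrite -[in X in X <= _]sizeq (leq_path_last _ Rq) // => ? ? /andP[].
have /andP[_ gtij] : descent q i (last i (take q s)).
  apply: path_last_rel Rq; first exact: descent_trans.
  by rewrite -size_eq0 sizeq -lt0n.
have [|u spl pre_u] := IHk _ _ Rs; first by rewrite size_drop leq_subRL // -mulSn.
set j := last i _ in leij gtij spl pre_u.
have pre_i : prefix (window q i) (take (j - i) (drop i W)).
  by rewrite /window -(@take_takel _ q (j - i)) ?prefix_take // leq_subRL; lia.
exists (take (j - i) (drop i W)) => //.
apply: splits_cons spl _; first by lia.
exact: lex_gt_prefix gtij pre_i pre_u.
Qed.

Lemma descent_coloring n q :
    0 < q -> ~ n_divisible n.+1 W ->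
  exists c : nat -> 'I_(n * q), forall i j, i < j ->
    lex_gt (window q i) (window q j) -> c i <> c j.
Proof.
move=> q_gt0 ndivW.
have [|c cP] := @chain_coloring (n * q) (descent q).
  move=> i s Rs; rewrite ltnNge; apply/negP => les.
  by have [u /splits_n_divisible spl _] := descent_splits q_gt0 Rs les; apply/ndivW/spl.
by exists c => i j ltij gtij; apply: cP; rewrite /= ltij.
Qed.

(** Descents that are already visible in the factor between the two
    positions. *)
Definition far_descent P := [rel i j | [&& i < j, lex_gt (window P i) (window P j)
  & take (j - i) (window P i) != take (j - i) (window P j)]].

(** The potential behind the logarithm.  Going left along the chain, either a new
    part is gained ([splits_cons]), or the first part [u] is shorter than both
    [P] and the step, so that extending it ([splits_extend]) at least doubles
    [size u + 1].  Fewer than [L] doublings fit below [P], so the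
    lexicographically ordered pair (number of parts, logarithm of the first part)
    increases at each element. *)
Lemma far_descent_splits P L i s :
    P < 2 ^ L -> path (far_descent P) i s ->
  exists m u, splits m i u /\
    size s <= L.+1 * m + minn (trunc_log 2 (size u).+1) L.
Proof.
move=> ltPL; elim: s i => [|j s IHs] i /=.
  by move=> _; exists 0, (drop i W); split=> //; apply: splits0.
move=> /andP[/and3P[ltij gtij neq_ij] /IHs[m [u [spl les]]]].
have leij := ltnW ltij.
have [gtiu|ngtiu] := boolP (lex_gt (take (j - i) (drop i W)) u).
  exists m.+1, (take (j - i) (drop i W)); split; first exact: splits_cons spl _.
  rewrite mulnS; move: les (geq_minr (trunc_log 2 (size u).+1) L); lia.
exists m, (take (j - i + size u) (drop i W)); split.
  exact/splits_extend/window_lex_gt/gtij.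
(* Otherwise [u] would be long enough to show the descent. *)
have small_u : size u < minn (j - i) P.
  rewrite ltnNge; apply: contra ngtiu => leu.
  apply: lex_gt_prefix (lex_gt_take gtij neq_ij) _ _.
    by rewrite /window -take_min minnC take_min prefix_take.
  have [us [_ eqW _]] := spl.
  by rewrite /window -take_min eqW takel_cat // prefix_take.
have lt_uP : size u < P by rewrite (leq_trans small_u) // geq_minr.
have le_uij : size u < j - i by rewrite (leq_trans small_u) // geq_minl.
have size_ext : size (take (j - i + size u) (drop i W)) = j - i + size u.
  rewrite size_takel // size_drop.
  have [us [_ eqW _]] := spl.
  have : size u <= size (drop j W) by rewrite eqW size_cat leq_addr.
  have : 0 < size (drop j W).
    rewrite lt0n; apply: contraTneq gtij => /size0nil.
    by rewrite /window => ->; case: (take _ _).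
  by rewrite size_drop; lia.
rewrite size_ext; apply: leq_trans (_ : (L.+1 * m + minn (trunc_log 2 (size u).+1) L).+1 <= _) => //.
rewrite -addnS leq_add2l.
have lt_log : trunc_log 2 (size u).+1 < L.
  rewrite -(ltn_exp2l _ _ (ltnSn 1)); apply: leq_ltn_trans (trunc_logP _ _) _ => //.
  by apply: leq_ltn_trans ltPL.
have le_log : trunc_log 2 (size u).+1 < trunc_log 2 (j - i + size u).+1.
  apply: trunc_log_max => //; rewrite expnS.
  have := @trunc_logP 2 (size u).+1 isT isT; lia.
by rewrite (minn_idPl (ltnW lt_log)) leq_min le_log.
Qed.

Lemma far_descent_coloring P L n :
    P < 2 ^ L -> ~ n_divisible n.+1 W ->
  exists c : nat -> 'I_(L.+1 * n), forall i j, far_descent P i j -> c i <> c j.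
Proof.
move=> ltPL ndivW; apply: chain_coloring => i s /(far_descent_splits ltPL)[m [u [spl les]]].
have ltmn : m < n by rewrite ltnNge; apply/negP => /(splits_n_divisible spl).
have : L.+1 * m.+1 <= L.+1 * n by rewrite leq_mul2l ltmn.
by rewrite mulnS; move: les (geq_minr (trunc_log 2 (size u).+1) L); lia.
Qed.

(** Along each colour the windows of length [P] weakly increase. *)
Definition separating (K : Type) P (c : nat -> K) := forall i j, i < j ->
  j + P <= size W -> lex_gt (window P i) (window P j) -> c i <> c j.

(** Descents that are not far are repetitions: the two tails agree over the
    distance between them.  A chain of [d + 1] such descents with one colour for
    [far_descent] is squeezed between its ends, so all its tails agree over the
    span of the chain; its smallest step is a period that fits [d] times into
    this span, which produces a d-th power.  So [d] more colours suffice. *)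
Lemma descent_coloring_long P L n d :
    0 < d -> P < 2 ^ L -> ~ n_divisible n.+1 W -> ~ has_power d W ->
  exists c : nat -> 'I_(L.+1 * n) * 'I_d, separating P c.
Proof.
move=> d_gt0 ltPL ndivW npowW.
have [h hP] := far_descent_coloring ltPL ndivW.
pose R := [rel i j | [&& i < j, j + P <= size W,
  lex_gt (window P i) (window P j) & h i == h j]].
have trR : transitive R.
  move=> y x z /= /and4P[ltxy _ gtxy /eqP ->] /and4P[ltyz -> gtyz ->].
  by rewrite (ltn_trans ltxy) // (lex_gt_trans gtxy).
have [i s Rs|e eP] := @chain_coloring d R; last first.
  exists (fun i => (h i, e i)) => i j ltij lejW gtij [eqh].
  by apply: eP; rewrite /= ltij lejW gtij eqh eqxx.
rewrite ltnNge; apply/negP => les; apply: npowW.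
have s_n0 : s != [::] by rewrite -size_eq0 -lt0n (leq_trans d_gt0).
have /and4P[ltij lejW gtij /eqP eqh] := path_last_rel trR s_n0 Rs.
set j := last i s in ltij lejW gtij eqh; pose q := j - i.
have eq_ij : take q (window P i) = take q (window P j).
  by apply/eqP; apply: contraPT eqh => neq; apply: hP; rewrite /= ltij gtij.
(* The windows differ, so they cannot agree on their whole length. *)
have ltqP : q < P.
  rewrite ltnNge; apply: contraL gtij => lePq.
  have size_window y : size (window P y) <= q.
    by rewrite size_take_min (leq_trans (geq_minl _ _)).
  by move: eq_ij; rewrite !take_oversize // => ->; rewrite lex_gtxx.
have eq_take y : y \in i :: s -> take q (drop y W) = take q (drop i W).
  move=> ys; rewrite -(take_takel (drop y W) (ltnW ltqP)) -(take_takel (drop i W) (ltnW ltqP)).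
  have [[->//|/and4P[_ _ gtiy _]] [->//|/and4P[_ _ gtyj _]]] := path_endpoints trR Rs ys.
  exact: take_sandwich gtiy gtyj eq_ij.
have [|||x [g [g_gt0 leg xs xgs]]] := @small_step d q i s; rewrite -/j.
- by rewrite lt0n size_eq0.
- by apply: sub_path Rs => x y /and4P[].
- by rewrite leq_mul2r les orbT.
apply: (@periodic_has_power _ d g x q) => //; first by apply: leq_trans leg _; rewrite leq_addr.
  have /allP/(_ _ xgs)/and4P[_ le_xg _ _] := order_path_min trR Rs.
  by apply: leq_trans le_xg; rewrite leq_add2l ltnW.
by rewrite !eq_take ?inE ?xgs ?orbT.
Qed.

Lemma separating_leq (K : Type) P q (c : nat -> K) i j :
    separating P c -> q <= P -> i < j -> j + P <= size W -> c i = c j ->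
  ~~ lex_gt (window q i) (window q j).
Proof.
move=> cP leqP ltij lej eqc; apply/negP => gtij; apply: cP eqc => //.
by apply: lex_gt_prefix gtij _ _; rewrite /window -(take_takel _ leqP) prefix_take.
Qed.

(** * From windows of length p to windows of length 3p *)

Definition determines (K : Type) (c : nat -> K) q a len := forall i j,
  a <= i < a + len -> a <= j < a + len -> c i = c j -> window q i = window q j.

(** In a block without new keys, let [i < j] have the same colour.  The key of
    [j] already occurs at some [z <= i], with the same colour and window; since
    windows weakly increase from [z] to [i] and from [i] to [j], all three are
    equal. *)
Lemma determines_block (K : Type) (K' : finType) (c : nat -> K)
    (key : nat -> K') P q a len S :
    separating P c -> q <= P -> a + len + P <= (size W).+1 ->
    (forall i j, a <= i < a + len -> a <= j < a + len -> key i = key j ->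
      c i = c j /\ window q i = window q j) ->
    #|K'| * S < len ->
  exists x, [/\ a <= x, x + S < a + len & determines c q x S.+1].
Proof.
move=> cP leqP leW keyP ltS.
have [x [leax ltxS xP]] := repeating_block key a ltS.
exists x; split=> //.
have sizew i : i < a + len -> size (window q i) = q.
  by move=> lti; rewrite size_takel // size_drop; lia.
suff main i j : x <= i -> i < j -> j <= x + S -> c i = c j ->
    window q i = window q j.
  move=> i j Hi Hj eqc; have [ltij|ltji|->//] := ltngtP i j.
    by apply: main => //; lia.
  by symmetry; apply: main => //; lia.
move=> lexi ltij lej eqc.
have [|k lek eqkey] := xP j; first by lia.
have [||eqck eqwk] := keyP _ _ _ _ eqkey; [by lia | by lia |].
apply: nlex_gt_antisym; first by rewrite !sizew //; lia.
  by apply: (separating_leq cP) => //; lia.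
have [->|neqki] := eqVneq i k; first by rewrite eqwk lex_gtxx.
by rewrite -eqwk; apply: (separating_leq cP) => //; first [congruence | lia].
Qed.

(** A window of length [3 p] is made of three windows of length [p].  The
    colouring [c0], known to determine short windows, and the colouring [c],
    wanted for the longer ones, may differ: this is used once, to pass from the
    cheap colouring of short windows to the one of long windows. When they
    coincide, the key has [#|K| ^ 3] values. *)
Lemma tripling (K K0 : Type) (K' : finType) (c : nat -> K) (c0 : nat -> K0)
    (key : nat -> K') P p a len S :
    separating P c -> 3 * p <= P -> a + len + P <= (size W).+1 ->
    (forall i j, key i = key j -> [/\ c i = c j, c0 i = c0 j,
      c0 (i + p) = c0 (j + p) & c0 (i + p + p) = c0 (j + p + p)]) ->
    determines c0 p a len -> 2 * p < #|K'| -> 0 < S -> #|K'| * S <= len ->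
  exists x, [/\ a <= x, x + S <= a + len & determines c (3 * p) x S].
Proof.
case: S => // S cP lepP leW keyP det0 ltp _; rewrite mulnS => leS.
have [|||||x [leax ltx detx]] := @determines_block _ _ c key P (3 * p) a (len - 2 * p) S.
- by [].
- by [].
- by lia.
- move=> i j Hi Hj /keyP[-> eq0 eq1 eq2]; split=> //.
  rewrite (_ : 3 * p = p + p + p) ?windowD; last by lia.
  rewrite (det0 i j) ?(det0 (i + p) (j + p)) //; try by lia.
  by rewrite !addnA (det0 (i + p + p) (j + p + p)) //; lia.
- by lia.
by exists x; split => //; lia.
Qed.

Lemma tripling_iter (K : finType) (c : nat -> K) P p t a len S :
    separating P c -> 3 ^ t * p <= P -> a + len + P <= (size W).+1 ->
    determines c p a len -> 0 < p -> 3 ^ t * p <= #|K| ^ 3 -> 0 < S ->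
    (#|K| ^ 3) ^ t * S <= len ->
  exists x, [/\ a <= x, x + S <= a + len & determines c (3 ^ t * p) x S].
Proof.
move=> cP + + + p_gt0 + S_gt0.
elim: t p p_gt0 a len => [|t IHt] p p_gt0 a len lepP leW det0 lepK leS.
  by exists a; split; rewrite ?leqnn ?mul1n //; first [lia | move=> i j Hi Hj; apply: det0; lia].
have K_gt0 : 0 < #|K| by apply/card_gt0P; exists (c 0).
have t3_gt0 : 0 < 3 ^ t by rewrite expn_gt0.
have [|||||||x [leax lex detx]] := @tripling _ _ _ c c
   (fun i => (c i, c (i + p), c (i + p + p))) P p a len ((#|K| ^ 3) ^ t * S) cP.
- by move: lepP; rewrite expnS; nia.
- by [].
- by move=> i j [-> -> ->].
- by [].
- by rewrite !card_prod mulnn -expnSr; move: lepK; rewrite expnS; nia.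
- by rewrite muln_gt0 S_gt0 !expn_gt0 K_gt0.
- by rewrite !card_prod mulnn -expnSr mulnA -expnS.
have [||||||y [leay ley dety]] := IHt (3 * p) _ x ((#|K| ^ 3) ^ t * S).
- by rewrite muln_gt0.
- by rewrite mulnA -expnSr.
- by lia.
- by [].
- by rewrite mulnA -expnSr.
- by [].
by exists y; split; [lia | lia | rewrite expnSr -mulnA].
Qed.

(** * Dividing along equal windows *)

Lemma drop_window P s z : s <= P -> drop s (window P z) = take (P - s) (drop (z + s) W).
Proof. by move=> les; rewrite (addnC z) -drop_drop take_drop subnK. Qed.

(** If the word [u] occurs at the disjoint positions [z :: zs] and its tails at
    the offsets [s :: ss] decrease, the k-th part starts at the k-th offset in
    the k-th occurrence. *)
Lemma window_splits P u z zs s ss :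
    path (fun x y => x + P <= y) z zs ->
    all (fun x => window P x == u) (z :: zs) ->
    path (fun x y => lex_gt (drop x u) (drop y u)) s ss ->
    all (fun x => x <= P) (s :: ss) -> size ss <= size zs ->
  exists2 v, splits (size ss) (z + s) v & prefix (drop s u) v.
Proof.
elim: ss s z zs => [|t ss IHss] s z zs.
  move=> _ /andP[/eqP <- _] _ /andP[les _] _; exists (drop (z + s) W); first exact: splits0.
  by rewrite drop_window // prefix_take.
case: zs => // y zs /= /andP[lezy gapy] /andP[/eqP eqz eqys] /andP[gtst gts] /andP[les les'] lesz.
have [v spl pre_v] := IHss t y zs gapy eqys gts les' lesz.
have pre_s : prefix (drop s u) (take (y + t - (z + s)) (drop (z + s) W)).
  by rewrite -eqz drop_window // -(@take_takel _ (P - s) (y + t - (z + s))) ?prefix_take; lia.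
exists (take (y + t - (z + s)) (drop (z + s) W)) => //.
apply: splits_cons spl _; first by move: (les') => /andP[]; lia.
exact: lex_gt_prefix gtst pre_s pre_v.
Qed.

(** Of two incomparable tails one is a prefix of the other, so the window has the period
    [t - s <= n] over a length at least [d * (t - s)]. *)
Lemma window_tails_comparable P d n z s t :
    0 < d -> n * d <= P -> z + P <= size W -> s < t <= n ->
    ~~ lex_gt (drop s (window P z)) (drop t (window P z)) ->
    ~~ lex_gt (drop t (window P z)) (drop s (window P z)) ->
  has_power d W.
Proof.
move=> d_gt0 leP leW ltst ngt ngt'.
have leP' : n <= P by nia.
have := incomparable_prefix ngt ngt'.
rewrite !drop_window; [|lia|lia].
have -> : z + t = z + s + (t - s) by lia.
have leW' : z + s + (t - s) + (P - t) <= size W by lia.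
have sizes : size (take (P - s) (drop (z + s) W)) = P - s.
  by rewrite size_takel // size_drop; lia.
have sizet : size (take (P - t) (drop (z + s + (t - s)) W)) = P - t.
  by rewrite size_takel // size_drop; lia.
rewrite sizes sizet => /(_ ltac:(lia)); rewrite prefixE sizet take_takel; last by lia.
move=> /eqP eqT; apply: (@periodic_has_power _ d (t - s) (z + s) (P - t)) => //.
  by rewrite subn_gt0; case/andP: ltst.
have : d * (t - s) + s <= d * n by nia.
by rewrite mulnC in leP; lia.
Qed.

Lemma sorted_offsets u n :
    (forall s t, s < t <= n ->
      lex_gt (drop s u) (drop t u) || lex_gt (drop t u) (drop s u)) ->
  exists2 ss, perm_eq ss (iota 0 n.+1) &
    sorted (fun x y => lex_gt (drop x u) (drop y u)) ss.
Proof.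
move=> comp; pose e := [rel s t : nat | (s == t) || lex_gt (drop s u) (drop t u)].
have tot_e : {in iota 0 n.+1 &, total e}.
  move=> s t; rewrite !mem_iota /= => lts ltt.
  have [ltst|ltts|->] := ltngtP s t; rewrite /e /= ?eqxx //.
    by have := comp s t; rewrite ltst => /(_ ltt) /orP[->|->]; rewrite ?orbT.
  by have := comp t s; rewrite ltts => /(_ lts) /orP[->|->]; rewrite ?orbT.
exists (sort e (iota 0 n.+1)); first by rewrite perm_sort.
have : sorted e (sort e (iota 0 n.+1)).
  by apply: (sort_sorted_in tot_e); apply/allP.
move: (iota_uniq 0 n.+1); rewrite -(sort_uniq e).
case: (sort _ _) => //= x s; rewrite -/(uniq (x :: s)); elim: s x => //= y s IHs x.
move=> /andP[]; rewrite inE negb_or => /andP[neq _] uniq_s /andP[exy es].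
by move: exy; rewrite (negbTE neq) /= => ->; apply: IHs.
Qed.

(** Among [#|K| * n + 1] positions at mutual distance [P], some [n + 1] have the same
    colour, hence carry the same window. *)
Lemma determined_divisible (K : finType) (c : nat -> K) P n d a len :
    0 < d -> 0 < P -> n * d <= P -> a + len + P <= (size W).+1 ->
    determines c P a len -> #|K| * n * P < len ->
  n_divisible n.+1 W \/ has_power d W.
Proof.
move=> d_gt0 P_gt0 leP leW detc ltlen.
have [|v ltv] := @pigeonhole K (fun k => c (a + k * P)) n (iota 0 (#|K| * n).+1).
  by rewrite size_iota.
set ks := [seq k <- _ | _] in ltv.
have ksP k : k \in ks -> k * P < len /\ c (a + k * P) = v.
  rewrite mem_filter mem_iota => /andP[/eqP -> /andP[_ ltk]]; split=> //.
  by apply: leq_ltn_trans ltlen; rewrite leq_mul2r; lia.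
have sorted_ks : sorted ltn ks by apply: sorted_filter (iota_ltn_sorted _ _); apply: ltn_trans.
case: ks => [|k ks] in ltv ksP sorted_ks *; first by [].
pose z := a + k * P; pose u := window P z.
have win_u k' : k' \in k :: ks -> window P (a + k' * P) = u.
  move=> kin; have [ltk' eqv'] := ksP _ kin; have [ltk eqv] := ksP _ (mem_head _ _).
  by apply: detc; rewrite ?eqv ?eqv' //; lia.
have [npow|npowW] := pselect (has_power d W); [by right | left].
have leWz : z + P <= size W by have [] := ksP _ (mem_head _ _); rewrite /z; lia.
have [s t lestn|ss permss sortss] := @sorted_offsets u n.
  apply/negPn; rewrite negb_or; apply/negP => /andP[ngt ngt'].
  by apply: npowW; apply: window_tails_comparable leP leWz lestn ngt ngt'.
have sizess := perm_size permss; rewrite size_iota in sizess.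
case: ss => // s ss in permss sortss sizess.
have [|||||v' spl _] := @window_splits P u z [seq a + x * P | x <- ks] s ss.
- rewrite -[z]/((fun x => a + x * P) k) path_map.
  apply: sub_path sorted_ks => x y /= ltxy.
  by rewrite -addnA -mulSnr leq_add2l leq_mul2r ltxy orbT.
- rewrite -[z :: _]/[seq a + x * P | x <- k :: ks] all_map.
  by apply/allP => x xin; apply/eqP/win_u.
- by [].
- apply/allP => x; rewrite (perm_mem permss) mem_iota /= => ltx.
  by apply: leq_trans leP; nia.
- by rewrite size_map; move: ltv sizess => /=; lia.
by apply: splits_n_divisible spl _; move: sizess => /=; lia.
Qed.
End Division.

(** * The length of words that are not divisible *)

(** The factors are those of the successive passages to subintervals: the
    single letters, [r] triplings with the [N0] colours of [descent_coloring],
    one tripling that changes the colouring, [m - r - 1] triplings with the [N]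
    colours of [descent_coloring_long], and the final pigeonhole. *)
Lemma size_bound (disp : Order.disp_t) (A : orderType disp) (F : finType)
    (code : A -> F) (W : seq A) (n d m r L : nat) (N := L.+1 * n * d) (N0 := n * 3 ^ r) :
    injective code -> 0 < n -> 0 < d -> n * d <= 3 ^ m -> r < m -> 3 ^ m < 2 ^ L ->
    3 ^ m <= N ^ 3 -> ~ n_divisible n.+1 W -> ~ has_power d W ->
  size W < 3 ^ m + #|F| * N0 * ((N0 ^ 3) ^ r *
    (N * N0 ^ 3 * ((N ^ 3) ^ (m - r.+1) * (N * n * 3 ^ m).+1))).
Proof.
move=> code_inj n_gt0 d_gt0 lend ltrm ltL leN ndivW npowW.
rewrite ltnNge; apply/negP => leW.
have exp3_gt0 k : 0 < 3 ^ k by rewrite expn_gt0.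
have [c0 c0P] := descent_coloring (exp3_gt0 r) ndivW.
have {c0P} proper0 : separating W (3 ^ r) c0 by move=> i j ltij _; apply: c0P.
have [c cP] := descent_coloring_long d_gt0 ltL ndivW npowW.
have cardN0 : #|'I_(n * 3 ^ r)| = N0 by rewrite card_ord.
have cardN : #|{: 'I_(L.+1 * n) * 'I_d}| = N by rewrite card_prod !card_ord.
have N0_ge : 3 ^ r <= N0 by rewrite leq_pmull.
have N0_gt0 : 0 < N0 by rewrite (leq_trans _ N0_ge).
have N_gt0 : 0 < N by rewrite !muln_gt0 n_gt0.
have L_gt1 : 1 < L.
  rewrite -(ltn_exp2l _ _ (ltnSn 1)); apply: leq_ltn_trans ltL.
  by apply: (@leq_trans (3 ^ 1)); rewrite // leq_exp2l // (leq_ltn_trans _ ltrm).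
have N_gt2 : 2 < N by rewrite /N -mulnA (leq_trans (_ : 2 < L.+1)) // leq_pmulr // muln_gt0 n_gt0.
have le_rm : 3 ^ r <= 3 ^ m by rewrite leq_exp2l // ltnW.
have N03 : N0 <= N0 ^ 3 by rewrite -[X in X <= _]expn1 leq_pexp2l.
clearbody N N0.
case: W => [|x0 W'] in leW ndivW npowW proper0 cP *.
  by move: leW (exp3_gt0 m) => /=; lia.
set W := x0 :: W' in leW ndivW npowW proper0 cP.
set S4 := (N * n * 3 ^ m).+1 in leW.
set S3 := (N ^ 3) ^ _ * _ in leW.
set S2 := N * N0 ^ 3 * _ in leW.
set S1 := (N0 ^ 3) ^ r * _ in leW.
have S3_gt0 : 0 < S3 by rewrite muln_gt0 !expn_gt0 N_gt0 ltn0Sn.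
have S2_gt0 : 0 < S2 by rewrite muln_gt0 S3_gt0 muln_gt0 N_gt0 expn_gt0 N0_gt0.
have S1_gt0 : 0 < S1 by rewrite muln_gt0 S2_gt0 !expn_gt0 N0_gt0.
have [|||x1 [_ lex1 det1]] := @determines_block _ _ W _
    ('I_(n * 3 ^ r) * F)%type c0 (fun i => (c0 i, code (nth x0 W i))) (3 ^ r) 1 0
    ((size W).+1 - 3 ^ m) S1.-1 proper0 (exp3_gt0 r).
- by lia.
- move=> i j /andP[_ lti] /andP[_ ltj] [-> /code_inj eqx]; split=> //.
  have [ltiW ltjW] : i < size W /\ j < size W by have := exp3_gt0 m; lia.
  by rewrite /window (drop_nth x0 ltiW) (drop_nth x0 ltjW) eqx /= !take0.
- rewrite card_prod cardN0 (mulnC N0).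
  have : 0 < #|F| * N0 by rewrite muln_gt0 N0_gt0 andbT; apply/card_gt0P; exists (code x0).
  by case: (S1) S1_gt0 leW => // S _; rewrite mulnS; lia.
rewrite prednK // in lex1 det1.
have [|||||x2 [lex12 lex2 det2]] := @tripling_iter _ _ W _ c0 (3 ^ r) 1 r x1 _ S2 proper0 _ _ det1 _ _ S2_gt0 _.
- by rewrite muln1.
- by lia.
- by [].
- by rewrite muln1 cardN0 (leq_trans N0_ge).
- by rewrite cardN0.
rewrite muln1 in det2.
have [|||||||x3 [lex23 lex3 det3]] := @tripling _ _ W _ _ _ c c0
    (fun i => (c i, (c0 i, c0 (i + 3 ^ r), c0 (i + 3 ^ r + 3 ^ r)))) (3 ^ m) (3 ^ r) x2 S2 S3 cP.
- by rewrite -expnS leq_exp2l.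
- by lia.
- by move=> i j [-> -> -> ->].
- by [].
- by rewrite card_prod cardN !card_prod cardN0 mulnn -expnSr; nia.
- by [].
- by rewrite card_prod cardN !card_prod cardN0 mulnn -expnSr.
have exp_rm : 3 ^ (m - r.+1) * (3 * 3 ^ r) = 3 ^ m by rewrite -expnS -expnD subnK.
have [|||||x4 [lex34 lex4 det4]] := @tripling_iter _ _ W _ c (3 ^ m) (3 * 3 ^ r) (m - r.+1) x3 _ S4 cP _ _ det3 _ _ (ltn0Sn _) _.
- by rewrite exp_rm.
- by lia.
- by rewrite -expnS.
- by rewrite exp_rm cardN.
- by rewrite cardN.
rewrite exp_rm in det4.
have [||||] := @determined_divisible _ _ W _ c (3 ^ m) n d x4 _ d_gt0 _ lend _ det4 _ => //.
- by lia.
- by rewrite cardN.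
Qed.

(** * The numerical estimate *)

Lemma leq_expl a b e : a <= b -> a ^ e <= b ^ e.
Proof. by case: e => // e; rewrite leq_exp2r. Qed.

(** Trades the logarithmic factor [2 m + 1] for powers of 4 and 3. *)
Lemma fourth_power_bound r : (8 * r + 9) ^ 4 <= 4 ^ 4 * 3 ^ (5 + r).
Proof.
have [ltr3|] := ltnP r 3; first by case: r ltr3 => [|[|[|]]] // _; lia.
move=> /subnK <-; elim: (r - 3) => [|k IHk]; first by lia.
have -> : 3 ^ (5 + (k.+1 + 3)) = 3 * 3 ^ (5 + (k + 3)) by rewrite -expnS.
rewrite mulnCA; apply: leq_trans (leq_mul (leqnn 3) IHk).
have -> : 8 * (k.+1 + 3) + 9 = 8 * (k + 3) + 9 + 8 by lia.
have : 33 <= 8 * (k + 3) + 9 by lia.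
move: (8 * _ + 9) => x lex; rewrite !expnS expn0; nia.
Qed.

(** What is left of the estimate after the powers of [n] and [l] cancel.  The
    logarithmic factor [2 m + 1] is raised to a power of about [9 m / 4]; since
    [d ^ 2] is at least [3 ^ m.-1], the right side exceeds [3 ^ (r * (3 * r + 4))]
    by a power of 3 quadratic in [m].  Fourth powers make all exponents integral
    and leave a comparison of quadratic polynomials in [r] and [s]. *)
Lemma core_bound r s d (m := 4 * r + s + 1) : s <= 3 -> 3 ^ (4 * r + s) <= d ^ 2 ->
  6 * 3 ^ (r * (3 * r + 4)) * (2 * m).+1 ^ (9 * r + 3 * s + 2)
    <= d ^ (3 * r + 7) * 4 ^ (3 * m + 5).
Proof.
move=> les3 led; rewrite -(leq_exp2r _ _ (isT : 0 < 4)) !expnMn.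
have leL : (2 * m).+1 ^ 4 <= 4 ^ 4 * 3 ^ (5 + r).
  by apply: leq_trans (fourth_power_bound r); rewrite leq_exp2r // /m; lia.
set e := 9 * r + 3 * s + 2.
rewrite -[((2 * m).+1 ^ e) ^ 4]expnM mulnC [e * 4]mulnC expnM.
apply: (@leq_trans ((4 ^ 4 * 3 ^ (5 + r)) ^ e * (3 ^ 7 * 3 ^ (r * (3 * r + 4) * 4)))).
  apply: leq_mul; first by rewrite leq_exp2r // /e; lia.
  by rewrite -[(3 ^ _) ^ 4]expnM leq_mul2r; apply/orP; right.
have -> : (d ^ (3 * r + 7)) ^ 4 = (d ^ 2) ^ (6 * r + 14).
  by rewrite -!expnM; congr (_ ^ _); lia.
apply: (@leq_trans ((3 ^ (4 * r + s)) ^ (6 * r + 14) * (4 ^ (4 * e) * 3 ^ (12 * r + 24)))).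
  rewrite expnMn -[(4 ^ 4) ^ e]expnM -[(3 ^ (5 + r)) ^ e]expnM.
  rewrite -[(3 ^ (4 * r + s)) ^ _]expnM -mulnA [leqRHS]mulnCA leq_mul2l -!expnD.
  by rewrite leq_exp2l // /e; apply/orP; right; nia.
rewrite leq_mul //; first by rewrite leq_exp2r //; lia.
have -> : (4 ^ (3 * m + 5)) ^ 4 = 4 ^ (4 * e) * 4 ^ (12 * r + 24).
  by rewrite -expnM -expnD; congr (_ ^ _); rewrite /e /m; lia.
by rewrite leq_mul2l leq_exp2r ?orbT //; lia.
Qed.

(** Once [n] is replaced by [n.+1] and [3 ^ m] by [3 * (n.+1 * d)], both sides are
    monomials with the same powers of [l] and [n.+1], except for the first
    summand on the left, which a factor 2 absorbs; [core_bound] compares what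
    remains. *)
Lemma total_bound l n d r s (m := 4 * r + s + 1)
    (N := (2 * m).+1 * n * d) (N0 := n * 3 ^ r) :
    s <= 3 -> 0 < l -> n < d -> 3 ^ (4 * r + s) <= n.+1 * d ->
  3 ^ m + l * N0 * ((N0 ^ 3) ^ r *
    (N * N0 ^ 3 * ((N ^ 3) ^ (m - r.+1) * (N * n * 3 ^ m).+1)))
    <= l * d ^ 2 * (4 * (n.+1 * d)) ^ (3 * m + 5).
Proof.
move=> les3 l_gt0 ltnd ltm.
pose M := (2 * m).+1 * n.+1 * d; pose M0 := n.+1 * 3 ^ r; pose e := 9 * r + 3 * s + 2.
have leN : N <= M by rewrite leq_mul2r leq_mul2l leqnSn !orbT.
have leN0 : N0 <= M0 by rewrite leq_mul2r leqnSn orbT.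
pose B := M0 ^ (3 * r + 4) * (M ^ e * (n.+1 * 3 ^ m)).
have led : 3 ^ (4 * r + s) <= d ^ 2.
  by apply: leq_trans ltm _; rewrite -mulnn leq_mul2r ltnd orbT.
have core := core_bound les3 led; rewrite -/m -/e in core.
have e1 : e = 1 + (1 + 3 * (m - r.+1)) by rewrite /e /m; lia.
have e2 : 3 * m + 5 = 3 * r + 4 + e + 2 by rewrite /e /m; lia.
have e3 : 2 + (3 * m + 5) = e.+1 + (3 * r + 7) by rewrite /e /m; lia.
have regroup x y z t : x ^ (3 * r + 4) * (y ^ e * (z * t)) =
    x * (x ^ (3 * r) * (y * x ^ 3 * (y ^ (3 * (m - r.+1)) * (y * z * t)))).
  rewrite e1 (_ : 3 * r + 4 = 1 + 3 * r + 3); last by lia.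
  rewrite !(expnD x) !(expnD y) !expn1.
  by move: (x ^ 3) (x ^ _) (y ^ _) => *; lia.
clearbody e.
have d_gt0 : 0 < d by apply: leq_ltn_trans ltnd.
have M_gt0 : 0 < M by rewrite !muln_gt0 /=.
have M0_gt0 : 0 < M0 by rewrite muln_gt0 /= expn_gt0.
have leB : 3 ^ m <= B.
  by rewrite /B !mulnA leq_pmull // !muln_gt0 !expn_gt0 M_gt0 M0_gt0.
have le1 : l * N0 * ((N0 ^ 3) ^ r *
    (N * N0 ^ 3 * ((N ^ 3) ^ (m - r.+1) * (N * n * 3 ^ m).+1))) <= l * B.
  have -> : l * B = l * M0 * ((M0 ^ 3) ^ r *
      (M * M0 ^ 3 * ((M ^ 3) ^ (m - r.+1) * (M * n.+1 * 3 ^ m)))).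
    by rewrite /B regroup -!expnM mulnA.
  have leS : (N * n * 3 ^ m).+1 <= M * n.+1 * 3 ^ m.
    apply: (@leq_ltn_trans (M * n * 3 ^ m)); first exact: leq_mul (leq_mul leN _) _.
    by rewrite mulnS mulnDl -[ltnLHS]add0n ltn_add2r muln_gt0 M_gt0 expn_gt0.
  by rewrite !leq_mul // !leq_expl.
apply: leq_trans (leq_add leB le1) _.
have le3m : 3 ^ m <= 3 * (n.+1 * d) by rewrite /m addn1 expnS leq_mul2l.
have leB' : B <= 3 ^ (r * (3 * r + 4)) * (2 * m).+1 ^ e * 3 *
    (n.+1 ^ (3 * m + 5) * d ^ e.+1).
  apply: (@leq_trans (M0 ^ (3 * r + 4) * (M ^ e * (n.+1 * (3 * (n.+1 * d)))))).
    by rewrite leq_mul2l leq_mul2l leq_mul2l le3m !orbT.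
  rewrite e2 /M0 /M !expnMn -expnM 2!(expnD n.+1 (_ + _)) -mulnn (expnS d).
  apply/eq_leq; move: (n.+1 ^ (3 * r + 4)) (n.+1 ^ e) (3 ^ _) (_ ^ e) (d ^ e).
  by clear; move: n.+1 => n' x y z t u; lia.
have le2 : B + l * B <= 2 * (l * B) by rewrite mul2n -addnn leq_add2r leq_pmull.
apply: leq_trans le2 _.
have -> : l * d ^ 2 * (4 * (n.+1 * d)) ^ (3 * m + 5) =
    l * (n.+1 ^ (3 * m + 5) * d ^ e.+1) * (d ^ (3 * r + 7) * 4 ^ (3 * m + 5)).
  rewrite !expnMn.
  have : d ^ 2 * d ^ (3 * m + 5) = d ^ e.+1 * d ^ (3 * r + 7).
    by rewrite -!expnD e3.
  move: (d ^ 2) (d ^ (3 * m + 5)) (d ^ e.+1) (d ^ (3 * r + 7)) => d1 d2 d3 d4 eqd.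
  transitivity (l * n.+1 ^ (3 * m + 5) * 4 ^ (3 * m + 5) * (d1 * d2)); first by lia.
  by rewrite eqd; lia.
apply: (@leq_trans (l * (n.+1 ^ (3 * m + 5) * d ^ e.+1) *
    (6 * 3 ^ (r * (3 * r + 4)) * (2 * m).+1 ^ e))); last by rewrite leq_mul2l core orbT.
have := leq_mul (leqnn (2 * l)) leB'.
by move: (3 ^ _) (_ ^ e) (_ ^ (3 * m + 5)) (d ^ _) (B) => *; lia.
Qed.

(** Writing [X = 4 n d], the number [Psi] is [l d ^ 2 X ^ (3 log_3 X + 5)]. *)
Lemma Psi_lower_bound (R : realType) n d l m : 0 < n -> 0 < d ->
    3 ^ m <= 4 * (n * d) ->
  ((l * d ^ 2 * (4 * (n * d)) ^ (3 * m + 5))%:R <= Psi R n d l)%R.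
Proof.
move=> n_gt0 d_gt0 leX.
have nd_gt0 : (0 < (n * d)%:R :> R)%R by rewrite ltr0n muln_gt0 n_gt0.
have X_ge1 : (1 <= (4 * (n * d))%:R :> R)%R by rewrite ler1n muln_gt0 /= muln_gt0 n_gt0.
have ln3_gt0 : (0 < ln 3 :> R)%R by rewrite ln_gt0 // ltr1n.
have lnX : (ln (4 * (n * d))%:R = ln 4 + ln (n * d)%:R :> R)%R.
  by rewrite natrM lnM ?posrE.
have le_m : (m%:R <= log3 (4 * (n * d))%:R :> R)%R.
  rewrite /log3 ler_pdivlMr // mulrC mulr_natr -lnXn // -natrX ler_ln ?posrE ?ltr0n ?expn_gt0 //.
    by rewrite ler_nat.
  by rewrite muln_gt0 /= muln_gt0 n_gt0.
have -> : (Psi R n d l = l%:R * d%:R ^+ 2 *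
    (4 * (n * d))%:R `^ (3 * log3 (4 * (n * d))%:R + 5))%R.
  have powRE (a b : R) : (0 < a)%R -> (a `^ b = expR (b * ln a))%R.
    by move=> a_gt0; rewrite /powR gt_eqF.
  rewrite /Psi /log3 !powRE ?(lt_le_trans _ X_ge1) // lnX.
  rewrite -mulrA mulrACA -expRD mulrC; congr (_ * _)%R.
  by congr expR; field; rewrite gt_eqF.
rewrite (natrM _ (l * d ^ 2)) (natrX _ _ (3 * m + 5)) (natrM _ l) (natrX _ d).
rewrite ler_wpM2l ?mulr_ge0 ?exprn_ge0 // -powR_mulrn ?ler0n // ler_powR //.
by rewrite natrD natrM lerD2r ler_wpM2l.
Qed.

Theorem mainTheorem4 (R : realType) (disp : Order.disp_t)
    (A : finOrderType disp) (l n d : nat)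
    (l_gt0 : (0 < l)%N) (n_gt0 : (0 < n)%N) (le_nd : (n <= d)%N)
    (cardA : #|A| = l) (W : seq A)
    (sizeW : (Psi R n d l <= (size W)%:R)%R) :
  has_power d W \/ n_divisible n W.
Proof.
case: n => [//|n] in n_gt0 le_nd sizeW *.
have [->|n_neq0] := eqVneq n 0.
  by right; exists [::], [:: W]; rewrite /= cats0.
have [|ndivW] := pselect (n_divisible n.+1 W); first by right.
have [|npowW] := pselect (has_power d W); first by left.
have d_gt0 : 0 < d by apply: leq_trans le_nd.
(* [P = 3 ^ m] is at least [n d], and [9 ^ r] is at most [d]. *)
pose m := up_log 3 (n.+1 * d); pose r := m.-1 %/ 4; pose s := m.-1 %% 4.
have nd_gt1 : 1 < n.+1 * d by nia.
have m_gt0 : 0 < m by rewrite up_log_gt0.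
have /andP[lt_nd le_ndP] := up_log_bounds (isT : 1 < 3) nd_gt1.
have m_eq : m = 4 * r + s + 1 by rewrite [4 * r]mulnC -divn_eq addn1 prednK.
have pred_m : m.-1 = 4 * r + s by rewrite m_eq addn1.
have ltm : 3 ^ (4 * r + s) <= n.+1 * d by rewrite -pred_m ltnW.
have le3m : 3 ^ m <= 3 * (n.+1 * d) by rewrite m_eq addn1 expnS leq_mul2l.
have := total_bound (ltn_pmod m.-1 (isT : 0 < 4)) l_gt0 le_nd ltm.
rewrite -m_eq -/s -/r leqNgt => /negP[].
apply: (@leq_trans (size W).+1).
  rewrite ltnS -(ler_nat R); apply: le_trans sizeW.
  by apply: Psi_lower_bound => //; apply: leq_trans le3m _; rewrite leq_mul2r orbT.
rewrite -cardA; apply: (@size_bound _ A A id W n d m r (2 * m)) => //.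
- by rewrite lt0n.
- by apply: leq_trans le_ndP; rewrite leq_mul2r leqnSn orbT.
- by rewrite m_eq; lia.
- by rewrite expnM ltn_exp2r.
apply: leq_trans le3m _; have : 3 * d <= (2 * m).+1 * n * d by rewrite leq_mul2r; nia.
by move/(leq_expl 3); apply: leq_trans; rewrite !expnS expn0; nia.
Qed.
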